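(* Let $R$ be a commutative ring with identity and $S\subseteq R$ a multiplicative set. Let $I$ be an ideal of $R$ which admits an $S$-primary decomposition, that is, let $I=\bigcap_{i=1}^{n}Q_i$ be a minimal $S$-primary decomposition of $I$, where $Q_i$ is $P_i$-$S$-primary. If $\{P_1,\ldots,P_m\}$ is a set of isolated $S$-prime ideals of $I$ for some $m$ $(1\le m\le n)$, then $Q_1\cap\cdots\cap Q_m$ is independent of $S$-primary decomposition.
   Context: A multiplicative set $S\subseteq R$ contains $1$ and is closed under multiplication. $\mathrm{rad}(I)=\{x\in R\mid x^n\in I\text{ for some }n>0\}$. For an ideal $I$ of $R$, $S(I)=\{a\in R\mid \frac{a}{1}\in S^{-1}I\}$ denotes the contraction of $S^{-1}I$ along the usual homomorphism $R\to S^{-1}R$, $r\mapsto \frac{r}{1}$. An ideal $Q$ of $R$ with $Q\cap S=\emptyset$ is $S$-primary if there exists $s\in S$ such that for all $a,b\in R$ with $ab\in Q$, we have $sa\in Q$ or $sb\in\mathrm{rad}(Q)$. An ideal $P$ with $P\cap S=\emptyset$ is $S$-prime if there exists $s\in S$ such that for all $a,b\in R$ with $ab\in P$, we have $sa\in P$ or $sb\in P$. If $Q$ is $S$-primary, then $P=\mathrm{rad}(Q)$ is $S$-prime, and $Q$ is then called $P$-$S$-primary. An ideal $I$ of $R$ with $I\cap S=\emptyset$ admits an $S$-primary decomposition if it is a finite intersection of $S$-primary ideals of $R$. An $S$-primary decomposition $I=\bigcap_{i=1}^n Q_i$ with $\mathrm{rad}(Q_i)=P_i$ for each $i$ is minimal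 if (1) $S(P_i)\ne S(P_j)$ for all distinct $i,j\in\{1,\ldots,n\}$, and (2) $S(Q_i)\nsupseteq\bigcap_{j\in\{1,\ldots,n\}\setminus\{i\}}S(Q_j)$ for each $i\in\{1,\ldots,n\}$ (equivalently, $S(Q_i)\nsupseteq\bigcap_{j\in\{1,\ldots,n\}\setminus\{i\}}Q_j$ for each $i$). Given such a minimal decomposition, the $S$-prime ideals $P_i$ are said to belong to $I$, and $P_i$ $(1\le i\le n)$ is called isolated $S$-prime if $sP_j\nsubseteq P_i$ for all $s\in S$ and all $j\ne i$.
   Formalization: Literal equality fails (in Z, S = powers of 2: (60)=(12)∩(20)=(6)∩(20)); what is proved independent is the contraction S(Q_1∩...∩Q_m), components of another minimal decomposition being matched to P_1,...,P_m by S(P'_j)=S(P_i). *)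

(* Defs.v *)
From mathcomp Require Import all_boot all_algebra.
From mathcomp Require Import classical_sets.

Set Implicit Arguments.
Unset Strict Implicit.
Unset Printing Implicit Defensive.

Import GRing.Theory.

Local Open Scope classical_set_scope.
Local Open Scope ring_scope.

(* Subsets of R are classical sets: the ideals of ring_quotient are decidable,
   proper, and live in a nontrivial ring, none of which is assumed here. *)
Section SPrimary.
Variable R : comPzRingType.
Implicit Types (S I P Q : set R).

Definition multiplicative_set S : Prop :=
  S 1 /\ (forall a b, S a -> S b -> S (a * b)).

Definition is_ideal I : Prop :=
  [/\ I 0, (forall x y, I x -> I y -> I (x + y))
    & (forall a x, I x -> I (a * x))].

Definition radical I : set R := [set x | exists2 n : nat, (0 < n)%N & I (x ^+ n)].

(* The fraction a/s of the localization of R at S, as an equivalence class of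
   pairs (numerator, denominator in S). *)
Definition loc_frac S (a s : R) : set (R * R) :=
  [set p | S p.2 /\ (exists2 u, S u & u * (p.1 * s - a * p.2) = 0)].

Definition loc_ideal S I : set (set (R * R)) :=
  [set loc_frac S x s | x in I & s in S].

(* S(I), the preimage of the localized ideal. Components of a decomposition can
   only be compared through it: in Z, with S the powers of 2,
   (60) = (12) /\ (20) = (6) /\ (20) are minimal S-primary decompositions with
   the same radicals (6), (10), both isolated, and (12) <> (6). *)
Definition contraction S I : set R := [set a | loc_ideal S I (loc_frac S a 1)].

Definition S_primary S Q : Prop :=
  [/\ is_ideal Q, Q `&` S = set0
    & exists2 s, S s &
        forall a b, Q (a * b) -> Q (s * a) \/ radical Q (s * b)].

Definition P_S_primary S P Q : Prop := S_primary S Q /\ radical Q = P.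

Definition S_primary_decomposition S I n (P Q : 'I_n -> set R) : Prop :=
  I = \bigcap_(i in [set: 'I_n]) Q i /\ (forall i, P_S_primary S (P i) (Q i)).

Definition minimal_S_primary_decomposition S I n (P Q : 'I_n -> set R) : Prop :=
  [/\ S_primary_decomposition S I P Q,
      (forall i j, i <> j -> contraction S (P i) <> contraction S (P j))
    & (forall i, ~ (\bigcap_(j in [set j | j <> i]) contraction S (Q j)
                      `<=` contraction S (Q i)))].

Definition isolated_S_prime S n (P : 'I_n -> set R) (i : 'I_n) : Prop :=
  forall s j, S s -> j <> i -> ~ ([set s * x | x in P j] `<=` P i).

(* The primes belonging to I are determined by I only through their
   contractions: in Z, with S the powers of 2, one has
   (30) = (6) /\ (5) = (3) /\ (10), and (6), (3) both contract to (3).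
   So a component of a decomposition with radicals P' corresponds to a
   component of index < m of a decomposition with radicals P when the
   contractions of their radicals agree. *)
Definition corresponding S n n' (P : 'I_n -> set R) (P' : 'I_n' -> set R)
    (m : nat) : set 'I_n' :=
  [set j | exists2 i : 'I_n, (i < m)%N &
             contraction S (P' j) = contraction S (P i)].

End SPrimary.

(* Main.v *)
(* Contraction along R -> S^-1 R turns an S-primary ideal Q into a primary
   ideal whose radical is the contraction of rad Q, and it commutes with finite
   intersections; S-isolated radicals become minimal primes. So the theorem is
   the classical second uniqueness theorem for the primary decompositions
   S(I) = /\ S(Q_i) = /\ S(Q'_j): the component q with minimal radical p is
   {x | t x \in S(I) for some t \notin p}, which only depends on S(I) and p. *)
Require Import Defs.
From mathcomp Require Import all_boot all_algebra.
From mathcomp Require Import boolp classical_sets.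

Import GRing.Theory.

Local Open Scope classical_set_scope.
Local Open Scope ring_scope.

Section Primary.
Context {R : comPzRingType}.
Implicit Types (S T A P Q p q : set R).

(* A [prime_set] or [primary] set is a prime or primary ideal except that it
   need not be closed under addition. *)
Definition absorbing A : Prop := forall a x, A x -> A (a * x).

Definition prime_set p : Prop :=
  [/\ absorbing p, ~ p 1 & forall a b, p (a * b) -> p a \/ p b].

Definition primary q : Prop :=
  [/\ absorbing q, ~ q 1 & forall a b, q (a * b) -> q a \/ radical q b].

Lemma multiplicative_set_exp {S} (hS : multiplicative_set S) {u} k :
  S u -> S (u ^+ k).
Proof.
move=> Su; elim: k => [|k IH]; first by rewrite expr0; case: hS.
by rewrite exprS; case: hS => _; apply.
Qed.

Lemma multiplicative_setC_prime {p} :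
  prime_set p -> multiplicative_set (~` p).
Proof.
by case=> _ p1 pM; split=> // a b na nb /pM [].
Qed.

(** Choose one witness per index and multiply them: absorption keeps the product in every [A k].
    With [T] the complement of a prime, or [T] equal to [S], this trades finitely many witnesses for
    a single one. *)
Lemma common_multiple {T n} {D : set 'I_n} {A : 'I_n -> set R} :
    multiplicative_set T -> (forall k, D k -> absorbing (A k)) ->
    (forall k, D k -> exists2 t, T t & A k t) ->
  exists2 t, T t & forall k, D k -> A k t.
Proof.
move=> [T1 TM] absA exA.
suff [t Tt At] : exists2 t, T t & forall k, k \in enum 'I_n -> D k -> A k t.
  by exists t => // k; apply: At; rewrite mem_enum.
elim: (enum 'I_n) => [|k r [t Tt At]]; first by exists 1.
have [Dk|nDk] := pselect (D k); last first.
  by exists t => // j; rewrite inE => /orP [/eqP -> //|]; apply: At.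
have [v Tv Av] := exA k Dk.
exists (v * t); first exact: TM.
move=> j; rewrite inE => /orP [/eqP -> _|jr Dj].
  by rewrite mulrC; apply: absA.
exact/absA/At.
Qed.

Lemma sub_radical A : A `<=` radical A.
Proof. by move=> x Ax; exists 1%N; rewrite ?expr1. Qed.

Lemma prime_radical {p} : prime_set p -> radical p `<=` p.
Proof.
move=> [_ p1 pM] x [k _]; elim: k => [|k IH]; first by rewrite expr0 => /p1.
by rewrite exprS => /pM [].
Qed.

Lemma sub_radicalS {A p} : prime_set p -> A `<=` p -> radical A `<=` p.
Proof.
move=> pp Ap x [k k0 Ax]; apply: (prime_radical pp).
by exists k => //; apply: Ap.
Qed.

Lemma primary_prime_radical {q} : primary q -> prime_set (radical q).
Proof.
move=> [absq q1 qM]; split.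
- by move=> a x [k k0 qx]; exists k => //; rewrite exprMn; apply: absq.
- by case=> k _; rewrite expr1n.
move=> a b [k k0]; rewrite exprMn => /qM [qa|[l l0 qb]].
  by left; exists k.
by right; exists (k * l)%N; rewrite ?muln_gt0 ?k0 // exprM.
Qed.

(** Otherwise each [q k] contains an element outside [p]; a common multiple of these lies in the
    intersection but, [p] being prime, not in [p]. *)
Lemma radical_sub_prime {n} {q : 'I_n -> set R} {p} :
    (forall k, absorbing (q k)) -> prime_set p ->
    \bigcap_(k in [set: 'I_n]) q k `<=` p ->
  exists k, radical (q k) `<=` p.
Proof.
move=> absq pp subp; apply: contrapT => nsub.
have [|t npt qt] := common_multiple (D := setT) (multiplicative_setC_prime pp)
  (fun k _ => absq k); last by apply: npt; apply: subp => k _; apply: qt.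
move=> k _; apply: contrapT => nt; apply: nsub; exists k.
apply: (sub_radicalS pp) => x qx; apply: contrapT => npx.
by apply: nt; exists x.
Qed.

(** From left to right, isolation provides one [t] outside [radical (q i)] that lies in every other
    component; from right to left, [t] cancels because [q i] is primary. *)
Lemma isolated_componentE {n} {q : 'I_n -> set R} {i} :
    (forall k, primary (q k)) ->
    (forall k, radical (q k) `<=` radical (q i) -> k = i) ->
  q i = [set x | exists2 t, ~ radical (q i) t &
                   (\bigcap_(k in [set: 'I_n]) q k) (t * x)].
Proof.
move=> qP iso; have pp := primary_prime_radical (qP i).
have absq k : absorbing (q k) by case: (qP k).
apply/seteqP; split=> x.
- move=> qx.
  have [||t npt qt] := common_multiple (D := [set k | k <> i]) (A := q)
    (multiplicative_setC_prime pp).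
  + by move=> k _; apply: absq.
  (* If [q k] had no element outside [radical (q i)], its radical would lie there too, forcing
     [k = i]. *)
  + move=> k nki; apply: contrapT => nt; apply/nki/iso/(sub_radicalS pp) => y qy.
    by apply: contrapT => npy; apply: nt; exists y.
  exists t => // k _; have [->|nki] := pselect (k = i); first exact: absq.
  by rewrite mulrC; apply/absq/qt.
- case=> t npt /(_ i I); rewrite mulrC.
  by case: (qP i) => _ _ qM /qM [].
Qed.

(** An equality a/1 = x/s holds up to a factor in [S], so clearing denominators puts a multiple of
    [a] by an element of [S] into [A]; conversely, a/1 = (ua)/u. *)
Lemma contractionE {S A} : multiplicative_set S -> absorbing A ->
  contraction S A = [set a | exists2 u, S u & A (u * a)].
Proof.
move=> [S1 SM] absA; apply/seteqP; split=> a.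
- case=> x Ax [s Ss] eq_frac.
  have : loc_frac S a 1 (a, 1).
    by split=> //=; exists 1; rewrite // !mulr1 subrr mulr0.
  rewrite -eq_frac => -[_ /= [u Su /eqP]].
  rewrite mulr1 mulrBr subr_eq0 => /eqP eq_ux.
  exists (u * s); first exact: SM.
  by rewrite -mulrA [s * a]mulrC eq_ux; apply: absA.
- case=> u Su Aua; exists (u * a) => //; exists u => //.
  have eq_num (b c : R) : b * u - u * a * c = u * (b * 1 - a * c).
    by rewrite mulrBr mulr1 [b * u]mulrC mulrA.
  apply/seteqP; split=> -[b c] [/= Sc [v Sv v0]]; split=> //=.
    by exists (v * u); [exact: SM | rewrite -mulrA -eq_num].
  by exists v => //; rewrite eq_num mulrCA v0 mulr0.
Qed.

Lemma absorbing_contraction {S A} : multiplicative_set S -> absorbing A ->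
  absorbing (contraction S A).
Proof.
move=> hS absA; rewrite contractionE // => a x [u Su Aux].
by exists u => //; rewrite mulrCA; apply: absA.
Qed.

Lemma absorbing_radical {A} : absorbing A -> absorbing (radical A).
Proof.
by move=> absA a x [k k0 Ax]; exists k => //; rewrite exprMn; apply: absA.
Qed.

Lemma contraction_bigcap {S n} {D : set 'I_n} {A : 'I_n -> set R} :
    multiplicative_set S -> (forall k, absorbing (A k)) ->
  contraction S (\bigcap_(k in D) A k) = \bigcap_(k in D) contraction S (A k).
Proof.
move=> hS absA; rewrite contractionE //; last first.
  by move=> a x Ax k Dk; apply/absA/Ax.
apply/seteqP; split=> x.
  by case=> u Su Aux k Dk; rewrite contractionE //; exists u => //; apply: Aux.
move=> Ax.
(* The multipliers that bring [x] into [A k] form an absorbing set, so one [u] in [S] serves all [k]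
   in [D]. *)
have [||u Su Au] := common_multiple (D := D) (A := fun k => [set u | A k (u * x)]) hS.
- by move=> k _ a u /= Aux; rewrite -mulrA; apply: absA.
- by move=> k Dk; move: (Ax k Dk); rewrite contractionE.
by exists u.
Qed.

Lemma contraction_radical {S A} : multiplicative_set S -> absorbing A ->
  contraction S (radical A) = radical (contraction S A).
Proof.
move=> hS absA; have absr := absorbing_radical absA.
rewrite !contractionE //; apply/seteqP; split=> x.
  case=> u Su [k k0]; rewrite exprMn => Aux; exists k => //.
  by exists (u ^+ k) => //; apply: multiplicative_set_exp.
case=> k k0 [u Su Aux]; exists u => //; exists k => //.
(* As the exponent is positive, [u ^+ k] is a multiple of [u]. *)
case: k k0 Aux => // k _ Aux.
by rewrite exprMn (exprSr u) -mulrA; apply: absA.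
Qed.

Lemma S_primary_absorbing {S Q} : S_primary S Q -> absorbing Q.
Proof. by case=> -[]. Qed.

Lemma S_primary_disjoint {S Q x} : S_primary S Q -> Q x -> ~ S x.
Proof.
by case=> _ QS _ Qx Sx; have : (Q `&` S) x by []; rewrite QS.
Qed.

(** The witness [s] of S-primality costs only a factor [s] or a power of [s], which contraction
    ignores; [1] stays outside because [Q] misses [S]. *)
Lemma contraction_S_primary {S Q} : multiplicative_set S -> S_primary S Q ->
  primary (contraction S Q).
Proof.
move=> hS QP; have absQ := S_primary_absorbing QP.
split; first exact: absorbing_contraction.
  rewrite contractionE // => -[u Su]; rewrite mulr1 => Qu.
  exact: (S_primary_disjoint QP Qu).
rewrite contractionE // => a b [u Su]; rewrite mulrA.
case: (QP) => _ _ [s Ss QM] /QM [Qsua|[k k0 Qsb]].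
  by left; exists (s * u); [case: hS => _; apply | rewrite -mulrA].
right; exists k => //; exists (s ^+ k); first exact: multiplicative_set_exp.
by rewrite -exprMn.
Qed.

(* The witness s of S-primality of Q works uniformly in x. *)
Lemma radical_contraction_sub {S P Q} : multiplicative_set S -> S_primary S Q ->
    P `<=` radical (contraction S Q) ->
  exists2 s, S s & [set s * x | x in P] `<=` radical Q.
Proof.
move=> hS QP subP; have absQ := S_primary_absorbing QP.
case: (QP) => _ _ [s Ss QM]; exists s => // _ [x Px <-].
have [k k0] := subP x Px; rewrite contractionE // => -[u Su].
(* The alternative [s * u] in [radical Q] would put a power of an element of [S] into [Q]. *)
rewrite mulrC => /QM [Qsx|[l l0 Qsu]].
  exists k => //; case: k k0 Qsx => // k _ Qsx.
  by rewrite exprMn exprSr -mulrA; apply: absQ.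
case: (S_primary_disjoint QP Qsu); apply: multiplicative_set_exp => //.
by case: hS => _; apply.
Qed.

(* The minimal prime radical (q i) is the radical of some q' j, and then it is
   minimal among the radicals of the q' k as well. *)
Lemma isolated_component_unique {n n'} {q : 'I_n -> set R} {q' : 'I_n' -> set R}
    {i} :
    (forall k, primary (q k)) -> (forall k, primary (q' k)) ->
    (forall j k, radical (q' j) = radical (q' k) -> j = k) ->
    \bigcap_(k in [set: 'I_n]) q k = \bigcap_(k in [set: 'I_n']) q' k ->
    (forall k, radical (q k) `<=` radical (q i) -> k = i) ->
  (exists j, radical (q' j) = radical (q i)) /\
  (forall j, radical (q' j) = radical (q i) -> q' j = q i).
Proof.
move=> qP qP' inj' eqI iso.
have below j : radical (q' j) `<=` radical (q i) ->
    radical (q' j) = radical (q i).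
  move=> sub_ji; apply/seteqP; split=> //.
  (* Some [radical (q k)] lies in [radical (q' j)], hence in [radical (q i)], so [k = i]. *)
  have [|||k sub_kj] := radical_sub_prime (q := q) (p := radical (q' j)).
  - by move=> k; case: (qP k).
  - exact: primary_prime_radical.
  - by rewrite eqI => x q'x; apply/sub_radical/q'x.
  by rewrite -{1}(iso k) //; apply: subset_trans sub_kj _.
split.
  have [|||j /below] := radical_sub_prime (q := q') (p := radical (q i)).
  - by move=> k; case: (qP' k).
  - exact: primary_prime_radical.
  - by rewrite -eqI => x qx; apply/sub_radical/qx.
  by exists j.
move=> j eq_rad; rewrite (isolated_componentE qP iso).
rewrite (isolated_componentE (i := j) qP') ?eq_rad ?eqI // => k.
by move=> /below eq_k; apply: inj'; rewrite eq_k.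
Qed.

End Primary.

Theorem theorem19 (R : comPzRingType) (S : set R) (hS : multiplicative_set S)
  (I : set R) (hI : is_ideal I) (hIS : I `&` S = set0)
  (n : nat) (P Q : 'I_n -> set R)
  (hQ : minimal_S_primary_decomposition S I P Q)
  (m : nat) (hm : (1 <= m <= n)%N)
  (hiso : forall i : 'I_n, (i < m)%N -> isolated_S_prime S P i)
  (n' : nat) (P' Q' : 'I_n' -> set R)
  (hQ' : minimal_S_primary_decomposition S I P' Q') :
  contraction S (\bigcap_(i in [set i : 'I_n | (i < m)%N]) Q i) =
  contraction S (\bigcap_(j in corresponding S P P' m) Q' j).
Proof.
case: hQ => -[defI QP] _ _; case: hQ' => -[defI' QP'] injP' _.
have absQ i : absorbing (Q i) by case: (QP i) => /S_primary_absorbing.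
have absQ' j : absorbing (Q' j) by case: (QP' j) => /S_primary_absorbing.
have radP i : contraction S (P i) = radical (contraction S (Q i)).
  by rewrite -contraction_radical //; case: (QP i) => _ ->.
have radP' j : contraction S (P' j) = radical (contraction S (Q' j)).
  by rewrite -contraction_radical //; case: (QP' j) => _ ->.
have key (i : 'I_n) : (i < m)%N ->
    (exists j, contraction S (P' j) = contraction S (P i)) /\
    (forall j, contraction S (P' j) = contraction S (P i) ->
               contraction S (Q' j) = contraction S (Q i)).
  move=> im.
  have [||||k sub_ki|[j eq_j] uniq_i] := isolated_component_unique (i := i)
    (q := fun k => contraction S (Q k)) (q' := fun k => contraction S (Q' k)).
  - by move=> k; apply: contraction_S_primary => //; case: (QP k).
  - by move=> k; apply: contraction_S_primary => //; case: (QP' k).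
  - move=> j k; rewrite -!radP' => eq_jk.
    by apply: contrapT => njk; apply: injP' njk eq_jk.
  - by rewrite -!contraction_bigcap // -defI -defI'.
  (* If [k <> i], some [s] in [S] would carry [P k] into [P i], against S-isolation. *)
  - apply: contrapT => nki.
    have [|s Ss] := radical_contraction_sub (P := P k) hS (QP i).1.
      apply: subset_trans sub_ki; rewrite -(QP k).2 -contraction_radical //.
      rewrite contractionE //; last exact: absorbing_radical.
      by move=> x Px; exists 1; [case: hS | rewrite mul1r].
    by rewrite (QP i).2; apply: hiso.
  split; first by exists j; rewrite radP radP'.
  by move=> k; rewrite radP radP'; apply: uniq_i.
(* The first inclusion uses only that matching components have equal contractions; the second also
   needs a match for each [i]. *)
rewrite !contraction_bigcap //; apply/seteqP; split=> x Qx.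
  by move=> j [i im eq_ji]; rewrite ((key i im).2 j eq_ji); apply: Qx.
move=> i im; have [[j eq_ji] eqQ] := key i im.
by rewrite -(eqQ j eq_ji); apply: Qx; exists i.
Qed.
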